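(* Let $\mathbb{K}=\mathbb{R}$ or $\mathbb{K}=\mathbb{C}$ and let $n\ge 2$ be an integer. Let $N\ge n$ be an integer and let $u_1,\ldots,u_N\in\mathbb{K}^n$ be vectors forming a tight frame in $\mathbb{K}^n$ with constant $1$. Let $t=(t_1,\ldots,t_N)\in\mathbb{R}^N$ be a vector with non-negative coordinates satisfying $\|t\|=1$. Then $$\sum_{i,j=1}^{N} t_it_j|\langle u_i,u_j\rangle|\le \delta_{\mathbb{K}}(n).$$ Moreover, equality holds if and only if there exist a maximal ETF $w_1,\ldots,w_d$ in $\mathbb{K}^n$ (where $d=d_{\mathbb{K}}(n)$) and a partition $\{1,\ldots,N\}=A_0\sqcup A_1\sqcup\ldots\sqcup A_d$ satisfying the following conditions: (1) $A_0=\{1\le i\le N: u_i=0\}$ and for all $1\le i\le N$ we have $t_i=0$ if and only if $i\in A_0$. (2) For every $1\le j\le d$ and every $i\in A_j$ there exists a unimodular scalar $\alpha_i\in\mathbb{K}$ such that $\frac{u_i}{\|u_i\|}=\alpha_i w_j$. (3) For every $1\le j\le d$ we have $\sum_{i\in A_j}t_i^2=\frac1d$ (in particular we must have $N\ge d$, as each set $A_1,\ldots,A_d$ has to be non-empty). (4) $\|u_i\|=\sqrt{n}\,t_i$ for every $1\le i\le N$.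
   Context: $\langle\cdot,\cdot\rangle$ is the standard inner product on $\mathbb{K}^n$ (linear in the first variable, conjugate-linear in the second) and $\|\cdot\|$ is the Euclidean norm. A unimodular scalar is $z\in\mathbb{K}$ with $|z|=1$. Vectors $u_1,\ldots,u_N\in\mathbb{K}^n$ form a tight frame with constant $\alpha$ if $x=\alpha\sum_{i=1}^N\langle x,u_i\rangle u_i$ for every $x\in\mathbb{K}^n$ (zero or repeated vectors are allowed). Define $$\delta_{\mathbb{R}}(n)=\frac{2}{n+1}\left(1+\frac{n-1}{2}\sqrt{n+2}\right),\qquad \delta_{\mathbb{C}}(n)=\frac1n\left(1+(n-1)\sqrt{n+1}\right),$$ $$d_{\mathbb{R}}(n)=\frac{n(n+1)}{2},\qquad d_{\mathbb{C}}(n)=n^2.$$ A set of pairwise distinct unit vectors $w_1,\ldots,w_m\in\mathbb{K}^n$ is equiangular if $|\langle w_i,w_j\rangle|$ is constant over all $1\le i<j\le m$. An equiangular set of unit vectors that is also a tight frame (with some constant) is an equiangular tight frame (ETF). A maximal ETF in $\mathbb{K}^n$ is an ETF consisting of exactly $d_{\mathbb{K}}(n)$ vectors (no equiangular set in $\mathbb{K}^n$ has more vectors). The sets in a partition $A_0\sqcup\ldots\sqcup A_d$ are pairwise disjoint and $A_0$ may be empty. *)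

(* Defs.v *)
From HB Require Import structures.
From mathcomp Require Import all_boot all_order all_algebra.
From mathcomp Require Import reals.
From mathcomp Require Import complex.

Set Implicit Arguments.
Unset Strict Implicit.
Unset Printing Implicit Defensive.

Import Order.TTheory GRing.Theory Num.Theory.
Local Open Scope ring_scope.

Variant scalar_kind := RealScalars | ComplexScalars.

Definition scalars (R : realType) (k : scalar_kind) : numFieldType :=
  match k with
  | RealScalars => R
  | ComplexScalars => R[i]
  end.

Definition of_real (R : realType) (k : scalar_kind) : R -> scalars R k :=
  match k with
  | RealScalars => fun x => x
  | ComplexScalars => fun x => (x%:C)%C
  end.

Definition conj_scalar (R : realType) (k : scalar_kind) :
    scalars R k -> scalars R k :=
  match k with
  | RealScalars => fun x => x
  | ComplexScalars => fun x => conjc x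
  end.

(* The modulus takes its values in R, whereas the library norm `|_| of R[i]
   takes its values in R[i]. *)
Definition modulus (R : realType) (k : scalar_kind) : scalars R k -> R :=
  match k with
  | RealScalars => fun x => `|x|
  | ComplexScalars => fun x => ComplexField.Normc.normc x
  end.

Arguments of_real {R} k x.
Arguments conj_scalar {R k} x.
Arguments modulus {R k} x.

Section Frames.
Variables (R : realType) (k : scalar_kind) (n : nat).
Local Notation K := (scalars R k).

Definition inner (x y : 'rV[K]_n) : K :=
  \sum_(l < n) x 0 l * conj_scalar (y 0 l).

Definition euclidean_norm (x : 'rV[K]_n) : R :=
  Num.sqrt (\sum_(l < n) modulus (x 0 l) ^+ 2).

Definition tight_frame (N : nat) (u : 'I_N -> 'rV[K]_n) (alpha : R) : Prop :=
  forall x : 'rV[K]_n, x = of_real k alpha *: \sum_(i < N) inner x (u i) *: u i.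

Definition equiangular (m : nat) (w : 'I_m -> 'rV[K]_n) : Prop :=
  [/\ injective w,
      forall i, euclidean_norm (w i) = 1
    & exists c : R, forall i j : 'I_m,
        (i < j)%N -> modulus (inner (w i) (w j)) = c].

Definition equiangular_tight_frame (m : nat) (w : 'I_m -> 'rV[K]_n) : Prop :=
  equiangular w /\ exists alpha : R, tight_frame w alpha.

End Frames.

Definition delta (R : realType) (k : scalar_kind) (n : nat) : R :=
  match k with
  | RealScalars =>
      2 / (n%:R + 1) * (1 + (n%:R - 1) / 2 * Num.sqrt (n%:R + 2))
  | ComplexScalars =>
      n%:R^-1 * (1 + (n%:R - 1) * Num.sqrt (n%:R + 1))
  end.

Definition max_equiangular (k : scalar_kind) (n : nat) : nat :=
  match k with
  | RealScalars => (n * n.+1) %/ 2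
  | ComplexScalars => n ^ 2
  end.

Definition maximal_ETF (R : realType) (k : scalar_kind) (n : nat)
    (w : 'I_(max_equiangular k n) -> 'rV[scalars R k]_n) : Prop :=
  equiangular_tight_frame w.

(* Unlike for finset's [partition], empty blocks are allowed. *)
Definition labelled_partition (T : finType) (m : nat) (A : 'I_m -> {set T}) :
    Prop :=
  (forall i j : 'I_m, i != j -> [disjoint A i & A j]) /\
  \bigcup_(i < m) A i = [set: T].

(* Main.v *)
Require Import Defs.
From HB Require Import structures.
From mathcomp Require Import all_boot all_order all_algebra.
From mathcomp Require Import reals.
From mathcomp Require Import complex.
From mathcomp Require Import ring lra.

Set Implicit Arguments.
Unset Strict Implicit.
Unset Printing Implicit Defensive.

Import Order.TTheory GRing.Theory Num.Theory.
Local Open Scope ring_scope.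

(** Write r = 2 (real case) or r = 1 (complex case), q = sqrt(n + r),
    a_i = t_i |u_i|, A = sum a_i, and let g_ij be the modulus of the inner product
    of u_i / |u_i| and u_j / |u_j|. In a maximal ETF the only values of g are 1
    and 1/q, so one bounds g by an even quartic polynomial touching it there: for
    0 <= g <= 1,
      (q g - 1)^2 (1 - g) (q g + q + 2)
        = (q + 2) + q (q^2 + 2 q + 3) g^2 - q^3 g^4 - 2 (q + 1)^2 g  >= 0.
    Summed against a_i a_j this bounds the sum of the theorem, because
    - sum a_i a_j g_ij^2 <= 1, by 2 a_i a_j <= t_i^2 |u_j|^2 + t_j^2 |u_i|^2 and
      the Parseval identity of the frame;
    - sum a_i a_j g_ij^4 >= (1 + r) A^2 / (n q^2), a Welch bound;
    - A^2 <= n, as |t| = 1 and sum |u_i|^2 = n.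
    In the case of equality |u_i| = sqrt(n) t_i and g takes only the values 1 and
    1/q; as the Welch bound says that a quadratic form in a is positive
    semidefinite, its equality case gives sum_j a_j g_ij^4 for each i, whence all
    classes of collinear vectors have the same weight 1/d. *)

(** * Conjugation and modulus, treated uniformly over both fields *)

Section Scalars.
Variables (R : realType) (k : scalar_kind).
Local Notation K := (scalars R k).

(** With the morphism lemmas that follow, the [rmorph] rewriting rules apply to [conj_scalar] and
    [of_real] without a case split on [k]. *)
Lemma conj_scalar_is_zmod_morphism : zmod_morphism (@conj_scalar R k).
Proof. by case: k => x y //=; rewrite rmorphB. Qed.

Lemma conj_scalar_is_monoid_morphism : monoid_morphism (@conj_scalar R k).
Proof. case: k; split=> //; [exact: rmorph1 | exact: rmorphM]. Qed.

HB.instance Definition _ :=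
  GRing.isZmodMorphism.Build K K (@conj_scalar R k) conj_scalar_is_zmod_morphism.
HB.instance Definition _ :=
  GRing.isMonoidMorphism.Build K K (@conj_scalar R k)
    conj_scalar_is_monoid_morphism.

Lemma of_real_is_zmod_morphism : zmod_morphism (@of_real R k).
Proof. by case: k => x y //=; rewrite rmorphB. Qed.

Lemma of_real_is_monoid_morphism : monoid_morphism (@of_real R k).
Proof. by case: k; split=> //; exact: rmorphM. Qed.

HB.instance Definition _ :=
  GRing.isZmodMorphism.Build R K (@of_real R k) of_real_is_zmod_morphism.
HB.instance Definition _ :=
  GRing.isMonoidMorphism.Build R K (@of_real R k) of_real_is_monoid_morphism.

Lemma of_real_inj : injective (@of_real R k).
Proof. by case: k => x y //= []. Qed.

Lemma conj_scalarK : involutive (@conj_scalar R k).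
Proof. by case: k => x //=; rewrite conjcK. Qed.

Lemma conj_of_real (a : R) : conj_scalar (of_real k a) = of_real k a.
Proof. by case: k => //; exact: conjc_real. Qed.

Lemma mul_conj_scalar (z : K) : z * conj_scalar z = of_real k (modulus z ^+ 2).
Proof.
move: z; case: k => z /=; first by rewrite -normrX ger0_norm ?sqr_ge0 ?expr2.
by rewrite -sqr_normc rmorphXn.
Qed.

Lemma modulus_ge0 (z : K) : 0 <= modulus z.
Proof.
by move: z; case: k => [z|[a b]] /=; [exact: normr_ge0 | exact: sqrtr_ge0].
Qed.

Lemma modulusM (z1 z2 : K) : modulus (z1 * z2) = modulus z1 * modulus z2.
Proof.
by move: z1 z2; case: k => z1 z2 /=; rewrite ?normrM ?ComplexField.Normc.normcM.
Qed.

Lemma modulus_eq0 (z : K) : (modulus z == 0) = (z == 0).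
Proof.
apply/eqP/eqP => [z0|->]; last first.
  by case: k; [exact: normr0 | exact: ComplexField.Normc.normc0].
have := mul_conj_scalar z; rewrite z0 expr0n rmorph0 => /eqP.
rewrite mulf_eq0 => /orP[/eqP //|/eqP cz0].
by rewrite -[z]conj_scalarK cz0 rmorph0.
Qed.

Lemma modulus_conj (z : K) : modulus (conj_scalar z) = modulus z.
Proof.
apply/eqP; rewrite -(@eqrXn2 _ 2) ?modulus_ge0 ?normr_ge0//; apply/eqP/of_real_inj.
by rewrite -!mul_conj_scalar conj_scalarK mulrC.
Qed.

Lemma modulus_of_real (a : R) : modulus (of_real k a) = `|a|.
Proof.
apply/eqP; rewrite -(@eqrXn2 _ 2) ?modulus_ge0 ?normr_ge0//; apply/eqP/of_real_inj.
by rewrite -!mul_conj_scalar conj_of_real real_normK ?num_real// expr2 rmorphM.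
Qed.

End Scalars.

(** * Hermitian products over finite index types and a Cauchy-Schwarz inequality for Gram data *)

Section HermitianProduct.
Variables (R : realType) (k : scalar_kind).
Local Notation K := (scalars R k).

Definition hdot (I : finType) (f g : I -> K) : K :=
  \sum_i f i * conj_scalar (g i).

Definition tensor (I J : finType) (f : I -> K) (g : J -> K) : I * J -> K :=
  fun p => f p.1 * g p.2.

Lemma hdot_conj (I : finType) (f g : I -> K) :
  hdot (fun i => conj_scalar (f i)) (fun i => conj_scalar (g i)) =
  conj_scalar (hdot f g).
Proof. by rewrite /hdot rmorph_sum; apply: eq_bigr => i _; rewrite rmorphM. Qed.

Lemma hdot_tensor (I J : finType) (f1 f2 : I -> K) (g1 g2 : J -> K) :
  hdot (tensor f1 g1) (tensor f2 g2) = hdot f1 f2 * hdot g1 g2.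
Proof.
rewrite /hdot big_distrlr pair_bigA; apply: eq_bigr => -[i j] _ /=.
by rewrite /tensor /= rmorphM; ring.
Qed.

Lemma hdotC (I : finType) (f g : I -> K) : hdot g f = conj_scalar (hdot f g).
Proof.
rewrite /hdot rmorph_sum; apply: eq_bigr => i _.
by rewrite rmorphM /= conj_scalarK mulrC.
Qed.

Lemma hdot_self (I : finType) (f : I -> K) :
  hdot f f = of_real k (\sum_i modulus (f i) ^+ 2).
Proof. by rewrite rmorph_sum; apply: eq_bigr => i _; rewrite mul_conj_scalar. Qed.

Lemma hdot_comb_self (I P : finType) (X : P -> I -> K) (v : P -> R) :
  let f := fun i => \sum_p of_real k (v p) * X p i in
  hdot f f = \sum_p \sum_q of_real k (v p * v q) * hdot (X p) (X q).
Proof.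
rewrite /= /hdot /=.
under eq_bigr => i _ do rewrite rmorph_sum big_distrlr /=.
rewrite exchange_big /=; apply: eq_bigr => p _.
rewrite exchange_big /=; apply: eq_bigr => q _.
rewrite mulr_sumr; apply: eq_bigr => i _.
by rewrite !rmorphM /= conj_of_real; ring.
Qed.

Lemma hdot_comb_l (I P : finType) (X : P -> I -> K) (v : P -> R) (g : I -> K) :
  hdot (fun i => \sum_p of_real k (v p) * X p i) g =
  \sum_p of_real k (v p) * hdot (X p) g.
Proof.
rewrite /hdot; under eq_bigr => i _ do rewrite mulr_suml.
rewrite exchange_big /=; apply: eq_bigr => p _.
by rewrite mulr_sumr; apply: eq_bigr => i _; ring.
Qed.

(** With [f] the combination of the [X p] with coefficients [v p], [S] its squared norm and [T] its
    product with [E], the vector [F = w f - T E] has squared norm [w (w S - T^2)], which must be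
    non-negative. *)
Lemma gram_cauchy_schwarz (I P : finType) (X : P -> I -> K) (E : I -> K)
    (h : P -> P -> R) (e : P -> R) (w : R) (v : P -> R) :
  (forall p q, hdot (X p) (X q) = of_real k (h p q)) ->
  (forall p, hdot (X p) E = of_real k (e p)) ->
  hdot E E = of_real k w -> 0 < w ->
  (\sum_p v p * e p) ^+ 2 <= w * \sum_p \sum_q v p * v q * h p q.
Proof.
move=> hh he hw w0.
set S := \sum_p \sum_q _; set T := \sum_p _.
pose f i := \sum_p of_real k (v p) * X p i.
pose F i := of_real k w * f i - of_real k T * E i.
have ff : hdot f f = of_real k S.
  rewrite hdot_comb_self rmorph_sum; apply: eq_bigr => p _.
  rewrite rmorph_sum; apply: eq_bigr => q _.
  by rewrite hh -rmorphM.
have fE : hdot f E = of_real k T.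
  rewrite hdot_comb_l rmorph_sum; apply: eq_bigr => p _.
  by rewrite he -rmorphM.
have Ef : hdot E f = of_real k T by rewrite hdotC fE conj_of_real.
have FF : hdot F F = of_real k (w * (w * S - T ^+ 2)).
  transitivity (of_real k w ^+ 2 * hdot f f
    - (of_real k w * of_real k T) * hdot f E -
    (of_real k w * of_real k T) * hdot E f + of_real k T ^+ 2 * hdot E E).
    rewrite /hdot !mulr_sumr -!sumrB -big_split /=; apply: eq_bigr => i _.
    by rewrite /F rmorphB !rmorphM /= !conj_of_real; ring.
  rewrite ff fE Ef hw !(rmorphM, rmorphB, rmorphXn) /=; ring.
have := hdot_self F; rewrite FF => /of_real_inj eF.
rewrite -subr_ge0 -(pmulr_rge0 _ w0) eF.
by apply: sumr_ge0 => i _; rewrite sqr_ge0.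
Qed.

End HermitianProduct.

(** * Inner product, norm and the identities of a tight frame *)

Section EuclideanSpace.
Variables (R : realType) (k : scalar_kind) (n : nat).
Local Notation K := (scalars R k).
Implicit Types x y : 'rV[K]_n.

Lemma innerE x y : inner x y = hdot (x 0) (y 0).
Proof. by []. Qed.

Lemma innerC x y : inner y x = conj_scalar (inner x y).
Proof. by rewrite !innerE hdotC. Qed.

Lemma modulus_innerC x y : modulus (inner y x) = modulus (inner x y).
Proof. by rewrite innerC modulus_conj. Qed.

Lemma innerZl (z : K) x y : inner (z *: x) y = z * inner x y.
Proof. by rewrite /inner mulr_sumr; apply: eq_bigr => l _; rewrite mxE mulrA. Qed.

Lemma innerZr (z : K) x y : inner x (z *: y) = conj_scalar z * inner x y.
Proof. by rewrite innerC innerZl rmorphM /= -innerC. Qed.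

Lemma innerBl x1 x2 y : inner (x1 - x2) y = inner x1 y - inner x2 y.
Proof.
by rewrite /inner -sumrB; apply: eq_bigr => l _; rewrite !mxE mulrBl.
Qed.

Lemma innerBr x y1 y2 : inner x (y1 - y2) = inner x y1 - inner x y2.
Proof. by rewrite innerC innerBl rmorphB /= -!innerC. Qed.

Lemma inner_suml (I : finType) (f : I -> 'rV[K]_n) y :
  inner (\sum_i f i) y = \sum_i inner (f i) y.
Proof.
rewrite /inner exchange_big /=; apply: eq_bigr => l _.
by rewrite summxE mulr_suml.
Qed.

Lemma euclidean_norm_ge0 x : 0 <= euclidean_norm x.
Proof. exact: sqrtr_ge0. Qed.

Lemma sqr_euclidean_norm x :
  euclidean_norm x ^+ 2 = \sum_l modulus (x 0 l) ^+ 2.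
Proof. by rewrite sqr_sqrtr// sumr_ge0// => l _; rewrite sqr_ge0. Qed.

Lemma inner_self x : inner x x = of_real k (euclidean_norm x ^+ 2).
Proof. by rewrite innerE hdot_self sqr_euclidean_norm. Qed.

Lemma euclidean_norm_eq0 x : (euclidean_norm x == 0) = (x == 0).
Proof.
apply/eqP/eqP => [x0|->]; last first.
  apply/eqP; rewrite -sqrf_eq0 sqr_euclidean_norm big1// => l _.
  by rewrite mxE; apply/eqP; rewrite sqrf_eq0 modulus_eq0.
apply/rowP => l; rewrite mxE; apply/eqP; rewrite -modulus_eq0 -sqrf_eq0.
have /eqP := sqr_euclidean_norm x; rewrite x0 expr0n /= eq_sym.
rewrite psumr_eq0 => [/allP/(_ l)|i _]; last by rewrite sqr_ge0.
by rewrite mem_index_enum /= => /(_ isT).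
Qed.

Lemma euclidean_normZ (z : K) x :
  euclidean_norm (z *: x) = modulus z * euclidean_norm x.
Proof.
apply/eqP; rewrite -(@eqrXn2 _ 2) ?euclidean_norm_ge0//; last first.
  by rewrite mulr_ge0 ?modulus_ge0 ?euclidean_norm_ge0.
apply/eqP; apply: (@of_real_inj R k).
rewrite -inner_self innerZl innerZr mulrA mul_conj_scalar inner_self.
by rewrite -rmorphM -exprMn.
Qed.

Lemma sqr_norm_sub_proj x y : euclidean_norm y = 1 ->
  euclidean_norm (x - inner x y *: y) ^+ 2 =
  euclidean_norm x ^+ 2 - modulus (inner x y) ^+ 2.
Proof.
move=> y1; apply: (@of_real_inj R k).
rewrite -inner_self innerBl !innerBr !innerZl !innerZr !inner_self y1.
by rewrite (innerC x y) rmorphB /= -mul_conj_scalar expr1n rmorph1; ring.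
Qed.

Lemma modulus_inner_le x y : euclidean_norm y = 1 ->
  modulus (inner x y) <= euclidean_norm x.
Proof.
move=> y1.
rewrite -(@ler_pXn2r _ 2) ?nnegrE ?modulus_ge0 ?euclidean_norm_ge0//.
by rewrite -subr_ge0 -sqr_norm_sub_proj// sqr_ge0.
Qed.

(** Equality case of Cauchy-Schwarz: the residual of the projection of [x] on [y] has norm zero. *)
Lemma collinear_of_modulus_inner x y :
  euclidean_norm x = 1 -> euclidean_norm y = 1 -> modulus (inner x y) = 1 ->
  x = inner x y *: y.
Proof.
move=> x1 y1 xy1; apply/eqP; rewrite -subr_eq0 -euclidean_norm_eq0 -sqrf_eq0.
by rewrite sqr_norm_sub_proj// x1 xy1 subrr.
Qed.

Lemma tight_frame_parseval (N : nat) (u : 'I_N -> 'rV[K]_n) (alpha : R) x :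
  tight_frame u alpha ->
  alpha * \sum_i modulus (inner x (u i)) ^+ 2 = euclidean_norm x ^+ 2.
Proof.
move=> hu; apply: (@of_real_inj R k); rewrite -inner_self {2}(hu x).
rewrite innerZl inner_suml rmorphM rmorph_sum /=; congr (_ * _).
by apply: eq_bigr => i _; rewrite innerZl (innerC x) mul_conj_scalar.
Qed.

(** This is the trace of the frame identity: coordinate [l] of its value at the [l]-th basis vector,
    summed over [l]. *)
Lemma tight_frame_trace (N : nat) (u : 'I_N -> 'rV[K]_n) (alpha : R) :
  tight_frame u alpha -> alpha * \sum_i euclidean_norm (u i) ^+ 2 = n%:R.
Proof.
move=> hu; apply: (@of_real_inj R k); rewrite rmorph_nat.
have e l : 1 = of_real k alpha * \sum_i of_real k (modulus (u i 0 l) ^+ 2).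
  have /(congr1 (fun v : 'rV[K]_n => v 0 l)) := hu (delta_mx 0 l).
  rewrite !mxE !eqxx /= mulr1n summxE => ->; congr (_ * _); apply: eq_bigr => i _.
  rewrite mxE /inner (bigD1 l)//= big1 => [|j jl].
    by rewrite mxE !eqxx mul1r addr0 mulrC mul_conj_scalar.
  by rewrite mxE (negPf jl) mul0r.
rewrite -{2}(card_ord n) -sum1_card natr_sum (eq_bigr _ (fun l _ => e l)).
rewrite -mulr_sumr rmorphM rmorph_sum exchange_big /=; congr (_ * _).
by apply: eq_bigr => i _; rewrite sqr_euclidean_norm rmorph_sum.
Qed.

End EuclideanSpace.

(* The parameter [r] of the header: [d = n (n + r - 1) / r] in both cases. *)
Definition real_rank (R : realType) (k : scalar_kind) : R :=
  match k with RealScalars => 2 | ComplexScalars => 1 end.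
Arguments real_rank R k : clear implicits.

(** * The Welch bound for fourth powers of inner products *)

Section FourthMoment.
Variables (R : realType) (k : scalar_kind) (n : nat).
Local Notation K := (scalars R k).
Local Notation r := (real_rank R k).
Local Notation I2 := ('I_n * 'I_n)%type.

(* The third pairing is present for real scalars only: its coefficient is 1 for
   [r = 2] and 0 for [r = 1]. *)
Definition pairing_tensor : I2 * I2 -> K := fun p =>
  ((p.1.1 == p.2.1) && (p.1.2 == p.2.2))%:R +
  ((p.1.1 == p.2.2) && (p.1.2 == p.2.1))%:R +
  of_real k (r - 1) * ((p.1.1 == p.1.2) && (p.2.1 == p.2.2))%:R.

(** The tensor product of two copies of [x] and two of its conjugate, arranged so that Gram entries
    are fourth powers of moduli. *)
Definition fourth_power (x : 'rV[K]_n) : I2 * I2 -> K :=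
  let cx := fun l => conj_scalar (x 0 l) in
  tensor (tensor (x 0) (x 0)) (tensor cx cx).

Lemma hdot_pairing_tensor (f : I2 * I2 -> K) :
  hdot f pairing_tensor =
  \sum_i \sum_j f ((i, j), (i, j)) + \sum_i \sum_j f ((i, j), (j, i)) +
  of_real k (r - 1) * \sum_i \sum_j f ((i, i), (j, j)).
Proof.
have sum_eq (T : finType) (c : T) (g : T -> K) : \sum_l (l == c)%:R * g l = g c.
  by rewrite (bigD1 c)//= eqxx mul1r big1 ?addr0// => l /negPf ->; rewrite mul0r.
have sum_diag (g : I2 -> K) : \sum_q (q.1 == q.2)%:R * g q = \sum_c g (c, c).
  transitivity (\sum_c \sum_e (e == c)%:R * g (c, e)).
    by rewrite pair_bigA; apply: eq_bigr => -[c e] _ /=; rewrite eq_sym.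
  by apply: eq_bigr => c _; rewrite sum_eq.
(* The three pairings, as conditions on [p] and [q]: [q] equals [p], [q] is [p] swapped, or both are
   diagonal. *)
transitivity (\sum_(p : I2) \sum_(q : I2) (
   (q == p)%:R * f (p, q) + (q == (p.2, p.1))%:R * f (p, q) +
   of_real k (r - 1) * ((p.1 == p.2)%:R * ((q.1 == q.2)%:R * f (p, q))))).
  rewrite /hdot /pairing_tensor pair_bigA /=; apply: eq_bigr => -[[i j] [c e]] _ /=.
  rewrite !xpair_eqE (eq_sym c i) (eq_sym e j) (eq_sym c j) (eq_sym e i).
  rewrite [(j == c) && _]andbC -!mulnb !(rmorphD, rmorphM, rmorph_nat) /=.
  by rewrite !conj_of_real; ring.
under eq_bigr => p _ do
  rewrite !big_split /= -!mulr_sumr (sum_eq _ p) (sum_eq _ (p.2, p.1)) sum_diag.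
rewrite !big_split /= -mulr_sumr sum_diag !pair_bigA /=.
by congr (_ + _ + _); apply: eq_bigr => -[].
Qed.

(** A pairing contracted with itself gives [n^2] and with a different one gives [n]. *)
Lemma hdot_pairing_tensor_self :
  hdot pairing_tensor pairing_tensor = of_real k ((1 + r) * (n%:R * (n%:R + r))).
Proof.
have sum_eq (i : 'I_n) : \sum_j (j == i)%:R = 1 :> K.
  by rewrite (bigD1 i)//= eqxx big1 ?addr0// => j /negPf ->.
have sum1 (c : K) : \sum_(i < n) c = n%:R * c.
  by rewrite sumr_const card_ord mulr_natl.
(* [r - 1] is 0 or 1, hence idempotent; this relation lets one ring computation cover both
   fields. *)
have rr : of_real k (r - 1) * of_real k (r - 1) = of_real k (r - 1).
  by rewrite -rmorphM; congr of_real; case: (k) => /=; ring.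
rewrite hdot_pairing_tensor /pairing_tensor /=.
set rho := of_real k (r - 1) in rr *.
rewrite (eq_bigr (fun=> n%:R + 1 + rho)) => [|i _]; last first.
  under eq_bigr => j _ do rewrite !eqxx [i == j]eq_sym !andbb /=.
  by rewrite !big_split /= -mulr_sumr sum1 sum_eq !mulr1.
rewrite [\sum_i \sum_j (_ + ((i == i) && _)%:R + _)]
  (eq_bigr (fun=> 1 + n%:R + rho)) => [|i _]; last first.
  under eq_bigr => j _ do rewrite !eqxx [i == j]eq_sym !andbb /=.
  by rewrite !big_split /= -mulr_sumr sum1 sum_eq !mulr1.
rewrite [\sum_i \sum_j (_ + ((i == j) && _)%:R + _)]
  (eq_bigr (fun=> 1 + 1 + rho * n%:R)) => [|i _]; last first.
  under eq_bigr => j _ do rewrite !eqxx [i == j]eq_sym !andbb /=.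
  by rewrite !big_split /= -mulr_sumr sum1 sum_eq !mulr1.
rewrite !sum1 (_ : 1 + r = 2 + (r - 1)); last by ring.
rewrite (_ : n%:R + r = n%:R + 1 + (r - 1)); last by ring.
move: (r - 1) @rho rr => c rho rr.
rewrite !(rmorphM, rmorphD, rmorph1, rmorph_nat) /= -/rho.
by ring: rr.
Qed.

Lemma hdot_fourth_power (x y : 'rV[K]_n) :
  hdot (fourth_power x) (fourth_power y) = of_real k (modulus (inner x y) ^+ 4).
Proof.
rewrite !hdot_tensor hdot_conj -innerE mulrACA mul_conj_scalar -rmorphM.
by rewrite -exprD.
Qed.

Lemma hdot_fourth_power_pairing (x : 'rV[K]_n) :
  hdot (fourth_power x) pairing_tensor =
  of_real k ((1 + r) * euclidean_norm x ^+ 4).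
Proof.
have e : \sum_l x 0 l * conj_scalar (x 0 l) = of_real k (euclidean_norm x ^+ 2).
  exact: inner_self.
rewrite hdot_pairing_tensor /fourth_power /tensor /=.
rewrite (_ : 1 + r = 1 + 1 + (r - 1)); last by ring.
(* The third pairing matches unconjugated factors with each other, so it yields the fourth power of
   the norm only where conjugation is trivial; otherwise its coefficient is zero. *)
have cid : of_real k (r - 1) = 0 \/ forall z : K, conj_scalar z = z.
  by case: (k); [right | left; rewrite /= subrr].
move: (r - 1) cid => c cid.
rewrite [in RHS]rmorphM !rmorphD rmorph1 !mulrDl mul1r /=.
have e4 : of_real k (euclidean_norm x ^+ 4) =
    \sum_i \sum_j (x 0 i * conj_scalar (x 0 i)) * (x 0 j * conj_scalar (x 0 j)).
  by rewrite -big_distrlr /= e -rmorphM -exprD.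
rewrite e4; congr (_ + _ + _).
- by apply: eq_bigr => i _; apply: eq_bigr => j _; ring.
- by apply: eq_bigr => i _; apply: eq_bigr => j _; ring.
case: cid => [->|cid]; first by rewrite !mul0r.
congr (_ * _); apply: eq_bigr => i _; apply: eq_bigr => j _.
by rewrite !cid; ring.
Qed.

(* Cauchy-Schwarz for the combination of the [fourth_power (x p)] against the
   tensor to which it is proportional when the [x p] form a projective 2-design. *)
Lemma fourth_moment (P : finType) (x : P -> 'rV[K]_n) (v : P -> R) :
  (0 < n)%N ->
  (1 + r) * (\sum_p v p * euclidean_norm (x p) ^+ 4) ^+ 2 <=
  n%:R * (n%:R + r) *
    \sum_p \sum_q v p * v q * modulus (inner (x p) (x q)) ^+ 4.
Proof.
move=> n0.
have r0 : 0 < r by case: (k) => /=.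
have r1 : 0 < 1 + r by rewrite addr_gt0.
have nr : 0 < n%:R * (n%:R + r) by rewrite mulr_gt0 ?addr_gt0 ?ltr0n.
have := gram_cauchy_schwarz v
  (fun p q => hdot_fourth_power (x p) (x q))
  (fun p => hdot_fourth_power_pairing (x p))
  hdot_pairing_tensor_self (mulr_gt0 r1 nr).
(* A common factor [1 + r] is extracted from the left-hand sum; after squaring, one copy cancels
   against the right side. *)
under eq_bigr => p _ do rewrite mulrCA.
by rewrite -mulr_sumr exprMn expr2 -!mulrA ler_pM2l.
Qed.

End FourthMoment.

(** The quadratic attains its minimum 0 at 0, so its slope there vanishes. Testing at
    [- b / (c + 1)] gives [- (b / (c + 1))^2], and the shift by 1 also covers [c = 0]. *)
Lemma linear_coef_eq0 (R : realFieldType) (b c : R) :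
  (forall x, 0 <= x * b + x ^+ 2 * c) -> b = 0.
Proof.
move=> h.
have c0 : 0 <= c by have := h 1; have := h (-1); nra.
have c1 : c + 1 != 0 by rewrite gt_eqF// ltr_wpDl.
have := h (- b / (c + 1)).
rewrite (_ : _ + _ = - (b / (c + 1)) ^+ 2); last by field.
rewrite oppr_ge0 => hb; have {hb} : (b / (c + 1)) ^+ 2 = 0.
  by apply/eqP; rewrite eq_le hb sqr_ge0.
by move/eqP; rewrite sqrf_eq0 mulf_eq0 invr_eq0 (negPf c1) orbF => /eqP.
Qed.

(** * The quartic bound for an abstract kernel [g], and its equality case *)

Section KernelBound.
Variables (R : rcfType) (I : finType) (s t : I -> R) (g : I -> I -> R).
Variables (n r q : R).
Hypotheses (n1 : 1 < n) (r0 : 0 < r) (rn : r <= n) (q0 : 0 < q)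
  (qq : q ^+ 2 = n + r).
Hypotheses (s0 : forall i, 0 <= s i) (t0 : forall i, 0 <= t i).
Hypotheses (tt : \sum_i t i ^+ 2 = 1) (ss : \sum_i s i ^+ 2 = n).
Hypotheses (g0 : forall i j, 0 <= g i j) (g1 : forall i j, g i j <= 1).
Hypothesis gC : forall i j, g j i = g i j.
Hypothesis parseval : forall i, \sum_j s j ^+ 2 * g i j ^+ 2 <= 1.
(** The support condition reflects that a zero frame vector has no direction: its normalisation is
    zero and adds nothing to the Welch bound. *)
Hypothesis moment : forall v : I -> R, (forall i, s i = 0 -> v i = 0) ->
  (1 + r) * (\sum_i v i) ^+ 2 <=
  n * q ^+ 2 * \sum_i \sum_j v i * v j * g i j ^+ 4.

Let a i := t i * s i.
Let A := \sum_i a i.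
Let S := \sum_i \sum_j a i * a j * g i j.
Let G2 := \sum_i \sum_j a i * a j * g i j ^+ 2.
Let G4 := \sum_i \sum_j a i * a j * g i j ^+ 4.
Let gap i j := (q * g i j - 1) ^+ 2 * (1 - g i j) * (q * g i j + q + 2).

Let n0 : 0 < n. Proof. exact: lt_trans n1. Qed.
Let a0 i : 0 <= a i. Proof. exact: mulr_ge0. Qed.
Let A0 : 0 <= A. Proof. by apply: sumr_ge0 => i _. Qed.

Let gap_ge0 i j : 0 <= gap i j.
Proof.
have qg : 0 <= q * g i j by rewrite mulr_ge0// ltW.
apply: mulr_ge0; first by apply: mulr_ge0; rewrite ?sqr_ge0// subr_ge0.
by rewrite !addr_ge0// ltW.
Qed.

Let gap_sum : \sum_i \sum_j a i * a j * gap i j =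
  (q + 2) * A ^+ 2 + q * (q ^+ 2 + 2 * q + 3) * G2 - q ^+ 3 * G4
  - 2 * (q + 1) ^+ 2 * S.
Proof.
have -> : A ^+ 2 = \sum_i \sum_j a i * a j by rewrite expr2 /A big_distrlr.
rewrite /G2 /G4 /S !mulr_sumr -!big_split -!sumrB /=; apply: eq_bigr => i _.
rewrite !mulr_sumr -!big_split -!sumrB /=; apply: eq_bigr => j _.
by rewrite /gap; ring.
Qed.

(** The distance to the bound is a combination of four slacks: the quartic gap, the Welch bound,
    Parseval, and [A^2 <= n]. The coefficients are positive, so the bound follows and equality
    annihilates every slack. *)
Let slack_identity :
  n * (2 * (q + 1) ^+ 2 * (q - r / (q + 1) - S)) =
  n * (\sum_i \sum_j a i * a j * gap i j)
  + q * (n * q ^+ 2 * G4 - (1 + r) * A ^+ 2)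
  + n * q * (q ^+ 2 + 2 * q + 3) * (1 - G2)
  + (n * (q + 2) - (1 + r) * q) * (n - A ^+ 2).
Proof.
have q1 : q + 1 != 0 by rewrite gt_eqF// addr_gt0.
rewrite gap_sum (_ : r = q ^+ 2 - n); last by rewrite qq; ring.
by field.
Qed.

Let G2_le1 : G2 <= 1.
Proof.
have e : \sum_i \sum_j t i ^+ 2 * s j ^+ 2 * g i j ^+ 2 <= 1.
  rewrite -tt; apply: ler_sum => i _.
  under eq_bigr => j _ do rewrite -mulrA.
  by rewrite -mulr_sumr ler_piMr ?sqr_ge0.
suff : 2 * G2 <= \sum_i \sum_j t i ^+ 2 * s j ^+ 2 * g i j ^+ 2
    + \sum_i \sum_j t i ^+ 2 * s j ^+ 2 * g i j ^+ 2 by lra.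
(* Exchanging the sums in one of the two equal copies swaps [i] and [j], so that the termwise
   difference becomes a square. *)
rewrite {2}exchange_big -big_split mulr_sumr; apply: ler_sum => i _.
rewrite -big_split mulr_sumr; apply: ler_sum => j _ /=.
rewrite (gC i j) -subr_ge0 /a.
rewrite (_ : _ - _ = ((t i * s j - t j * s i) * g i j) ^+ 2); last by ring.
exact: sqr_ge0.
Qed.

Let sqrtn : Num.sqrt n ^+ 2 = n.
Proof. by rewrite sqr_sqrtr// ltW. Qed.

Let sqrtn0 : 0 < Num.sqrt n.
Proof. by rewrite sqrtr_gt0. Qed.

(** Serves twice: it gives [A <= sqrt n], and when [A = sqrt n] it forces [s] to be proportional to
    [t]. *)
Let A_dist : \sum_i (s i - Num.sqrt n * t i) ^+ 2 =
  2 * Num.sqrt n * (Num.sqrt n - A).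
Proof.
transitivity (\sum_i s i ^+ 2 - 2 * Num.sqrt n * A + n * \sum_i t i ^+ 2).
  rewrite /A !mulr_sumr -sumrB -big_split /=; apply: eq_bigr => i _.
  by rewrite /a; ring: sqrtn.
by rewrite ss tt; ring: sqrtn.
Qed.

Let A_le : A <= Num.sqrt n.
Proof.
rewrite -subr_ge0 -(@pmulr_rge0 _ (2 * Num.sqrt n)) ?mulr_gt0//.
by rewrite -A_dist sumr_ge0// => i _; rewrite sqr_ge0.
Qed.

Let AA_le : A ^+ 2 <= n.
Proof. by have := A_le; have := A0; have := sqrtn; nra. Qed.

Let moment_a : 0 <= n * q ^+ 2 * G4 - (1 + r) * A ^+ 2.
Proof.
rewrite subr_ge0; apply: (moment (v := a)) => i si0.
by rewrite /a si0 mulr0.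
Qed.

Let coef_gt0 : 0 < n * (q + 2) - (1 + r) * q.
Proof.
(* As [r q <= n q], the coefficient is at least [2 n - q], which this bound makes positive. *)
have qn : q <= n + 1 / 2.
  have n2 : 0 <= n + 1 / 2 by have := n1; lra.
  rewrite -(@ler_pXn2r _ 2) ?nnegrE ?(ltW q0)// qq.
  by have := rn; have := sqr_ge0 (n - 1 / 2); lra.
have := n1; have := ler_wpM2r (ltW q0) rn; lra.
Qed.

Let gap_sum_ge0 : 0 <= \sum_i \sum_j a i * a j * gap i j.
Proof.
apply: sumr_ge0 => i _; apply: sumr_ge0 => j _.
by apply: mulr_ge0 (gap_ge0 i j); exact: mulr_ge0.
Qed.

Let slope_gt0 : 0 < n * q * (q ^+ 2 + 2 * q + 3).
Proof. by rewrite mulr_gt0 ?mulr_gt0// !addr_gt0 ?mulr_gt0 ?exprn_gt0. Qed.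

Lemma kernel_bound : S <= q - r / (q + 1).
Proof.
have K0 : 0 < n * (2 * (q + 1) ^+ 2).
  by rewrite !mulr_gt0 ?exprn_gt0 ?addr_gt0.
rewrite -subr_ge0 -(pmulr_rge0 _ K0) -mulrA slack_identity.
apply: addr_ge0; last by apply: mulr_ge0 (ltW coef_gt0) _; rewrite subr_ge0.
apply: addr_ge0; last by apply: mulr_ge0 (ltW slope_gt0) _; rewrite subr_ge0.
exact: addr_ge0 (mulr_ge0 (ltW n0) gap_sum_ge0) (mulr_ge0 (ltW q0) moment_a).
Qed.

Hypothesis extremal : S = q - r / (q + 1).

Let extremal_terms :
  [/\ \sum_i \sum_j a i * a j * gap i j = 0,
      n * q ^+ 2 * G4 - (1 + r) * A ^+ 2 = 0 & A ^+ 2 = n].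
Proof.
have := slack_identity; rewrite extremal subrr !mulr0 => e.
have h1 := mulr_ge0 (ltW n0) gap_sum_ge0.
have h2 := mulr_ge0 (ltW q0) moment_a.
have := mulr_ge0 (ltW slope_gt0) (_ : 0 <= 1 - G2).
rewrite subr_ge0 => /(_ G2_le1) h3.
have := mulr_ge0 (ltW coef_gt0) (_ : 0 <= n - A ^+ 2).
rewrite subr_ge0 => /(_ AA_le) h4.
split; apply/eqP.
- by rewrite -(mulrI_eq0 _ (lregP (lt0r_neq0 n0))); apply/eqP; lra.
- by rewrite -(mulrI_eq0 _ (lregP (lt0r_neq0 q0))); apply/eqP; lra.
rewrite eq_sym -subr_eq0 -(mulrI_eq0 _ (lregP (lt0r_neq0 coef_gt0))).
by apply/eqP; lra.
Qed.

Let A_eq : A = Num.sqrt n.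
Proof.
have [_ _ AA] := extremal_terms.
by rewrite -AA sqrtr_sqr ger0_norm.
Qed.

Lemma extremal_norms i : s i = Num.sqrt n * t i.
Proof.
have := A_dist; rewrite A_eq subrr mulr0 => /eqP.
rewrite psumr_eq0 => [/allP/(_ i)|j _]; last exact: sqr_ge0.
by rewrite mem_index_enum sqrf_eq0 subr_eq0 => /(_ isT)/eqP.
Qed.

Let a_eq i : a i = Num.sqrt n * t i ^+ 2.
Proof. by rewrite /a extremal_norms; ring. Qed.

Let a_neq0 i : s i != 0 -> a i != 0.
Proof.
move=> si; rewrite /a mulf_neq0//.
by apply: contraNneq si => ti; rewrite extremal_norms ti mulr0.
Qed.

(** At equality [gap i j] vanishes wherever both weights are positive; its last factor is positive,
    which leaves the roots 1 and [1/q]. *)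
Lemma extremal_angles i j : s i != 0 -> s j != 0 ->
  g i j = 1 \/ q * g i j = 1.
Proof.
move=> /a_neq0 ai /a_neq0 aj.
have [/eqP + _ _] := extremal_terms.
have ge0 i' : 0 <= \sum_j a i' * a j * gap i' j.
  by apply: sumr_ge0 => j' _; apply: mulr_ge0 (gap_ge0 i' j'); exact: mulr_ge0.
rewrite psumr_eq0// => /allP/(_ i); rewrite mem_index_enum => /(_ isT) /=.
rewrite psumr_eq0 => [/allP/(_ j)|j' _]; last first.
  by apply: mulr_ge0 (gap_ge0 i j'); exact: mulr_ge0.
rewrite mem_index_enum => /(_ isT) /=.
rewrite mulf_eq0 (negPf (mulf_neq0 ai aj)) /= /gap 2!mulf_eq0 sqrf_eq0 !subr_eq0.
rewrite [q * g i j + q + 2 == 0]gt_eqF ?orbF; last first.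
  by rewrite -addrA ltr_wpDl ?addr_gt0// mulr_ge0// ltW.
by case/orP => /eqP; [right | left].
Qed.

(* The moment form is positive semidefinite and vanishes at [a], so [a] lies in
   its kernel. *)
Let extremal_moment i : s i != 0 ->
  n * q ^+ 2 * (\sum_j a j * g i j ^+ 4) = (1 + r) * A.
Proof.
move=> si; apply/eqP; rewrite -subr_eq0; apply/eqP.
set b := _ - _; suff : 2 * b = 0 by lra.
(* Let [e] be the indicator of [i]. Along [a + x e] the slack of the moment inequality is a
   quadratic in [x] with linear coefficient [2 b] and zero constant term. As [s i] is nonzero,
   [a + x e] satisfies the support condition. *)
apply: (@linear_coef_eq0 _ _ (n * q ^+ 2 * g i i ^+ 4 - (1 + r))) => x.
pose e j : R := (j == i)%:R.
have sume (f : I -> R) : \sum_j e j * f j = f i.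
  rewrite (bigD1 i)//= /e eqxx mul1r big1 ?addr0// => j /negPf ->.
  by rewrite mul0r.
have supp j : s j = 0 -> a j + x * e j = 0.
  move=> sj; rewrite /a sj mulr0 add0r /e; case: eqP => [ji|_]; last exact: mulr0.
  by rewrite -ji sj eqxx in si.
have := moment supp.
have -> : \sum_j (a j + x * e j) = A + x.
  rewrite big_split /= -mulr_sumr; congr (_ + _).
  by rewrite -[RHS]mulr1 -(sume (fun=> 1)); under [in RHS]eq_bigr do rewrite mulr1.
have -> : \sum_j \sum_l (a j + x * e j) * (a l + x * e l) * g j l ^+ 4 =
    G4 + 2 * x * (\sum_j a j * g i j ^+ 4) + x ^+ 2 * g i i ^+ 4.
  have -> : g i i ^+ 4 = \sum_j \sum_l e j * e l * g j l ^+ 4.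
    rewrite -(sume (fun j => g j i ^+ 4)); apply: eq_bigr => j _.
    rewrite -(sume (fun l => g j l ^+ 4)) mulr_sumr; apply: eq_bigr => l _.
    by rewrite mulrA.
  have e1 : \sum_j a j * g i j ^+ 4 = \sum_j \sum_l e j * a l * g j l ^+ 4.
    rewrite -(sume (fun j => \sum_l a l * g j l ^+ 4)); apply: eq_bigr => j _.
    by rewrite mulr_sumr; apply: eq_bigr => l _; rewrite mulrA.
  have e2 : \sum_j a j * g i j ^+ 4 = \sum_j \sum_l a j * e l * g j l ^+ 4.
    rewrite e1 exchange_big; apply: eq_bigr => j _; apply: eq_bigr => l _.
    by rewrite (gC l j); ring.
  rewrite mulr2n mulrDl mul1r mulrDl {1}e1 e2 /G4.
  rewrite !mulr_sumr -!big_split /=; apply: eq_bigr => j _.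
  rewrite !mulr_sumr -!big_split /=; apply: eq_bigr => l _.
  by ring.
have [_ h _] := extremal_terms.
set B := \sum_j _; rewrite -subr_ge0 (_ : _ - _ = x * (2 * b) +
  x ^+ 2 * (n * q ^+ 2 * g i i ^+ 4 - (1 + r)) +
  (n * q ^+ 2 * G4 - (1 + r) * A ^+ 2)).
  by rewrite h addr0.
by rewrite /b -/B; ring.
Qed.

(** Since [g i j] is 1 on the class of [i] and [1/q] on the rest of the support, [extremal_moment]
    becomes a linear equation for the weight [W] of that class. *)
Lemma extremal_weights i : s i != 0 ->
  \sum_(j | (s j != 0) && (g i j == 1)) t j ^+ 2 = r / (n * (n + r - 1)).
Proof.
move=> si; have := extremal_moment si.
set W := \sum_(j | _ && _) _.
have aW : \sum_(j | (s j != 0) && (g i j == 1)) a j = Num.sqrt n * W.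
  by rewrite /W mulr_sumr; apply: eq_bigr => j _; rewrite a_eq.
have -> : \sum_j a j * g i j ^+ 4 =
    Num.sqrt n * W + q ^- 4 * (A - Num.sqrt n * W).
  rewrite (bigID (fun j => (s j != 0) && (g i j == 1))) /= -aW; congr (_ + _).
    by apply: eq_bigr => j /andP[_ /eqP ->]; rewrite expr1n mulr1.
  rewrite /A [X in X - _](bigID (fun j => (s j != 0) && (g i j == 1))) /=.
  rewrite addrAC subrr add0r mulr_sumr; apply: eq_bigr => j.
  case: (eqVneq (s j) 0) => [sj _|sj /= gij]; first by rewrite /a sj !mulr0 mul0r.
  case: (extremal_angles si sj) => [gij1|qg]; first by rewrite gij1 eqxx in gij.
  by rewrite -exprVn -[g i j](mulKf (lt0r_neq0 q0)) qg mulr1 mulrC.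
have nr1 : n + r - 1 != 0 by rewrite gt_eqF//; have := n1; have := r0; lra.
rewrite A_eq => e.
have {}e : n * q ^+ 2 * (W + q ^- 4 * (1 - W)) = 1 + r.
  apply: (mulfI (lt0r_neq0 sqrtn0)); rewrite [RHS]mulrC -e; ring.
have {}e : (n * (q ^+ 4 - 1)) * W = (1 + r) * q ^+ 2 - n.
  rewrite -e; field; exact: lt0r_neq0.
have q4 : n * (q ^+ 4 - 1) != 0.
  apply: mulf_neq0; first exact: lt0r_neq0.
  rewrite (exprM q 2 2) qq.
  rewrite (_ : _ - 1 = (n + r - 1) * (n + r + 1)); last by ring.
  by rewrite mulf_neq0// gt_eqF// !addr_gt0.
(* With [q^2 = n + r] the right side is [r (n + r + 1)], and [q^4 - 1] is
   [(n + r - 1) (n + r + 1)]. *)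
apply: (mulfI q4); rewrite e (exprM q 2 2) qq; field.
by rewrite nr1 lt0r_neq0.
Qed.

End KernelBound.

(** * The constants of the theorem in terms of [n], [r] and [q], and the angle of a maximal ETF *)

Section Constants.
Variables (R : realType) (k : scalar_kind) (n : nat).
Hypothesis n_ge2 : (2 <= n)%N.
Local Notation r := (real_rank R k).
Local Notation d := (max_equiangular k n).
Let q : R := Num.sqrt (n%:R + r).

Lemma real_rank_gt0 : 0 < r.
Proof. by case: (k). Qed.

Lemma real_rank_le : r <= n%:R.
Proof.
have n2 : 2 <= n%:R :> R by rewrite ler_nat.
by case: (k) => //=; apply: le_trans n2; rewrite ler1n.
Qed.

Lemma natr_gt1 : 1 < n%:R :> R.
Proof. by rewrite ltr1n. Qed.

Lemma sqr_inv_angle : q ^+ 2 = n%:R + r.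
Proof. by rewrite sqr_sqrtr// addr_ge0// ltW// real_rank_gt0. Qed.

Lemma inv_angle_gt1 : 1 < q.
Proof.
have := natr_gt1; have := real_rank_gt0; have := sqr_inv_angle.
have : 0 <= q by exact: sqrtr_ge0.
nra.
Qed.

(** Both definitions are [r / (n + r - 1) * (1 + (n - 1) / r * q)], which simplifies because
    [n + r - 1 = (q - 1) (q + 1)]. *)
Lemma deltaE : delta R k n = q - r / (q + 1).
Proof.
have q1 := inv_angle_gt1; have qq := sqr_inv_angle.
have q10 : q + 1 != 0 by rewrite gt_eqF//; lra.
have q11 : q - 1 != 0 by rewrite gt_eqF//; lra.
have -> : delta R k n = r / (n%:R + r - 1) * (1 + (n%:R - 1) / r * q).
  rewrite /delta /q; case: (k) => /=.
    by rewrite -addrA (_ : 2 - 1 = 1)//; ring.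
  by rewrite addrK divr1 mul1r.
rewrite (_ : n%:R = q ^+ 2 - r); last by rewrite qq addrK.
field; rewrite q10 lt0r_neq0 ?real_rank_gt0// subrK.
by rewrite (_ : _ - 1 = (q + 1) * (q - 1)) ?mulf_neq0//; ring.
Qed.

Lemma max_equiangularE : d%:R = n%:R * (n%:R + r - 1) / r :> R.
Proof.
case: (k) => /=; last by rewrite addrK divr1 natrX expr2.
apply: (mulIf (_ : 2 != 0 :> R)); first by rewrite pnatr_eq0.
rewrite divfK ?pnatr_eq0// -natrM divnK ?natrM; last first.
  by rewrite dvdn2 oddM /= andbN.
by rewrite -natr1; ring.
Qed.

Lemma max_equiangular_gt1 : 1 < d%:R :> R.
Proof.
have n1 := natr_gt1; have r0 := real_rank_gt0.
rewrite max_equiangularE ltr_pdivlMr// mul1r.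
have rn := real_rank_le; nra.
Qed.

(** The trace gives [alpha = n / d], and Parseval at any [w i] gives [alpha (1 + (d - 1) c^2) = 1];
    the value of [d] then yields [c^2 = 1 / (n + r)]. *)
Lemma maximal_ETF_angle (w : 'I_d -> 'rV[scalars R k]_n) : maximal_ETF w ->
  forall i j, i != j -> modulus (inner (w i) (w j)) = q^-1.
Proof.
move=> [[_ w1 [c wc]] [alpha tf]].
have d1 := max_equiangular_gt1; have n1 := natr_gt1; have r0 := real_rank_gt0.
have {}wc (i j : 'I_d) : i != j -> modulus (inner (w i) (w j)) = c.
  rewrite -(inj_eq val_inj) neq_ltn => /orP[|] ij; first exact: wc.
  by rewrite modulus_innerC; apply: wc.
have tr : alpha * d%:R = n%:R.
  rewrite -(tight_frame_trace tf); congr (_ * _).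
  under eq_bigr do rewrite w1 expr1n.
  by rewrite sumr_const card_ord.
have par (i : 'I_d) : alpha * (1 + (d%:R - 1) * c ^+ 2) = 1.
  have := tight_frame_parseval (w i) tf; rewrite w1 expr1n => e.
  rewrite -[RHS]e; congr (_ * _).
  rewrite (bigD1 i)//= inner_self w1 expr1n rmorph1.
  have -> : modulus (1 : scalars R k) = 1.
    by rewrite -(rmorph1 (@of_real R k)) modulus_of_real normr1.
  rewrite expr1n; congr (_ + _).
  rewrite (eq_bigr (fun=> c ^+ 2)) => [|j ji]; last by rewrite wc// eq_sym.
  have d_gt0 : (1 <= d)%N by rewrite -(ler1n R) ltW.
  by rewrite sumr_const cardC1 card_ord -[RHS]mulr_natl -subn1 natrB.
move=> i j ij; rewrite wc//.
have c0 : 0 <= c by rewrite -(wc _ _ ij) modulus_ge0.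
have cc : c ^+ 2 = (n%:R + r)^-1.
  have {par} e := par i.
  have d0 : d%:R != 0 :> R by rewrite gt_eqF// (lt_trans _ d1).
  have ae : alpha = n%:R / d%:R by rewrite -tr mulfK.
  have nr1 : n%:R + r - 1 != 0 by rewrite gt_eqF//; lra.
  have nr0 : n%:R + r != 0 by rewrite gt_eqF//; lra.
  have nn1 : n%:R - 1 != 0 :> R by rewrite gt_eqF//; lra.
  have nn0 : n%:R != 0 :> R by rewrite gt_eqF//; lra.
  rewrite ae in e; have {}e : (d%:R - 1) * c ^+ 2 = d%:R / n%:R - 1.
    have nd0 : n%:R / d%:R != 0 :> R by rewrite mulf_neq0// invr_neq0.
    have <- : 1 + (d%:R - 1) * c ^+ 2 = d%:R / n%:R.
      by apply: (mulfI nd0); rewrite e; field; rewrite nn0.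
    by rewrite addrAC subrr add0r.
  have dd : d%:R - 1 != 0 :> R by rewrite subr_eq0 gt_eqF.
  apply: (mulfI dd); rewrite e max_equiangularE; field.
  by rewrite nr0 nn0 lt0r_neq0.
by rewrite -[c]ger0_norm// -sqrtr_sqr cc sqrtrV// addr_ge0// ltW.
Qed.

End Constants.

(** * Normalised frame vectors, their cosines and collinearity classes *)

Section NormalizedFrame.
Variables (R : realType) (k : scalar_kind) (n N : nat).
Variable u : 'I_N -> 'rV[scalars R k]_n.
Local Notation K := (scalars R k).
Local Notation r := (real_rank R k).

(* [0] when [u i = 0], so that [cosine] then vanishes as well. *)
Definition unit_vector (i : 'I_N) : 'rV[K]_n :=
  of_real k (euclidean_norm (u i))^-1 *: u i.

Definition cosine (i j : 'I_N) : R :=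
  modulus (inner (unit_vector i) (unit_vector j)).

Let s i := euclidean_norm (u i).

Lemma scale_unit_vector i : u i = of_real k (s i) *: unit_vector i.
Proof.
have [ui|ui] := eqVneq (u i) 0.
  by rewrite /unit_vector ui !scaler0.
by rewrite scalerA -rmorphM mulfV ?euclidean_norm_eq0// rmorph1 scale1r.
Qed.

Lemma unit_vector_norm i : u i != 0 -> euclidean_norm (unit_vector i) = 1.
Proof.
move=> ui; rewrite euclidean_normZ modulus_of_real ger0_norm.
  by rewrite mulVf// euclidean_norm_eq0.
by rewrite invr_ge0 euclidean_norm_ge0.
Qed.

Lemma unit_vector_norm_le1 i : euclidean_norm (unit_vector i) <= 1.
Proof.
have [ui|ui] := eqVneq (u i) 0; last by rewrite unit_vector_norm.
by rewrite (_ : euclidean_norm _ = 0)//; apply/eqP;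
  rewrite euclidean_norm_eq0 /unit_vector ui scaler0.
Qed.

Lemma modulus_inner_cosine i j :
  modulus (inner (u i) (u j)) = s i * s j * cosine i j.
Proof.
rewrite {1}(scale_unit_vector i) {1}(scale_unit_vector j) innerZl innerZr.
rewrite !modulusM modulus_conj !modulus_of_real !ger0_norm ?euclidean_norm_ge0//.
by rewrite mulrA.
Qed.

Lemma cosine_ge0 i j : 0 <= cosine i j.
Proof. exact: modulus_ge0. Qed.

Lemma cosineC i j : cosine j i = cosine i j.
Proof. exact: modulus_innerC. Qed.

Lemma cosine_le1 i j : cosine i j <= 1.
Proof.
have [uj|uj] := eqVneq (u j) 0.
  rewrite /cosine /unit_vector uj scaler0 innerC /inner big1 => [|l _].
    by rewrite rmorph0 (_ : modulus 0 = 0)//; apply/eqP; rewrite modulus_eq0.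
  by rewrite mxE mul0r.
apply: le_trans (unit_vector_norm_le1 i).
exact/modulus_inner_le/unit_vector_norm.
Qed.

Lemma cosine_self i : u i != 0 -> cosine i i = 1.
Proof.
move=> ui; rewrite /cosine inner_self unit_vector_norm// expr1n.
by rewrite modulus_of_real normr1.
Qed.

Lemma cosine_parseval i : tight_frame u 1 ->
  \sum_j s j ^+ 2 * cosine i j ^+ 2 <= 1.
Proof.
move=> /(tight_frame_parseval (unit_vector i)); rewrite mul1r => e.
have -> : \sum_j s j ^+ 2 * cosine i j ^+ 2 = euclidean_norm (unit_vector i) ^+ 2.
  rewrite -e; apply: eq_bigr => j _; rewrite {1}(scale_unit_vector j) innerZr.
  rewrite modulusM modulus_conj modulus_of_real exprMn.
  by rewrite ger0_norm ?euclidean_norm_ge0.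
by rewrite expr_le1// ?euclidean_norm_ge0// unit_vector_norm_le1.
Qed.

Lemma cosine_moment (v : 'I_N -> R) : (0 < n)%N ->
  (forall i, s i = 0 -> v i = 0) ->
  (1 + r) * (\sum_i v i) ^+ 2 <=
  n%:R * Num.sqrt (n%:R + r) ^+ 2 * \sum_i \sum_j v i * v j * cosine i j ^+ 4.
Proof.
move=> n0 vs; have := fourth_moment unit_vector v n0.
have -> : \sum_p v p * euclidean_norm (unit_vector p) ^+ 4 = \sum_p v p.
  apply: eq_bigr => p _; have [up|up] := eqVneq (u p) 0.
    by rewrite vs ?mul0r//; apply/eqP; rewrite euclidean_norm_eq0 up.
  by rewrite unit_vector_norm// expr1n mulr1.
by rewrite sqr_sqrtr ?addr_ge0// ltW// real_rank_gt0.
Qed.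

Lemma cosine1_eq i j : u i != 0 -> u j != 0 -> cosine i j = 1 ->
  exists2 z : K, modulus z = 1 & unit_vector i = z *: unit_vector j.
Proof.
move=> ui uj ij; exists (inner (unit_vector i) (unit_vector j)) => //.
by apply: collinear_of_modulus_inner; rewrite // unit_vector_norm.
Qed.

(** Unit vectors with cosine 1 differ by a unimodular factor, invisible to the modulus. Cosine 1 is
    thus an equivalence relation on the nonzero vectors. *)
Lemma cosine1_trans i j l : u i != 0 -> u j != 0 -> cosine i j = 1 ->
  cosine i l = cosine j l.
Proof.
move=> ui uj /(cosine1_eq ui uj)[z z1 e].
by rewrite /cosine e innerZl modulusM z1 mul1r.
Qed.

(** Every collinearity class has weight [1/d] and the total weight is 1, so there are exactly [d]
    classes; [rho] picks one index from each. *)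
Lemma cosine_representatives (d : nat) (f : 'I_N -> R) :
  (0 < d)%N -> \sum_(i | u i != 0) f i = 1 ->
  (forall i, u i != 0 ->
    \sum_(j | (u j != 0) && (cosine i j == 1)) f j = 1 / d%:R) ->
  exists rho : 'I_d -> 'I_N,
    [/\ forall j, u (rho j) != 0,
        forall j l, cosine (rho j) (rho l) = 1 -> j = l
      & forall i, u i != 0 -> exists j, cosine (rho j) i = 1].
Proof.
move=> d0 f1 fd.
pose h i := [set j | (u j != 0) && (cosine i j == 1)].
have hE i j : u i != 0 -> u j != 0 -> (h j == h i) = (cosine i j == 1).
  move=> ui uj; apply/eqP/eqP => [e|ij].
    have : j \in h j by rewrite inE uj cosine_self//= eqxx.
    by rewrite e inE => /andP[_ /eqP].
  by apply/setP => l; rewrite !inE (cosine1_trans l ui uj ij).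
pose P := h @: [set i | u i != 0].
have inP i : u i != 0 -> h i \in P by move=> ui; rewrite imset_f ?inE.
have cP : #|P| = d.
  apply/eqP; rewrite -(eqr_nat R); apply/eqP.
  have d0R : d%:R != 0 :> R by rewrite pnatr_eq0 -lt0n.
  move: f1; rewrite (partition_big h (mem P))//= => f1.
  apply: (mulIf (invr_neq0 d0R)); rewrite mulfV// -[RHS]f1 mulr_natl -sumr_const.
  apply: eq_bigr => B BP; have [i + ->] := imsetP BP; rewrite inE => ui.
  rewrite -div1r -(fd i ui); apply: eq_bigl => j.
  by case: (boolP (u j != 0)) => //= uj; rewrite hE.
(* The count [cP] lets ['I_d] enumerate the classes. *)
have /fin_all_exists[rho rhoP] : forall j : 'I_d, exists i : 'I_N,
    (u i != 0) && (h i == enum_val (cast_ord (esym cP) j)).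
  move=> j; have [i + e] := imsetP (enum_valP (cast_ord (esym cP) j)).
  rewrite inE => ui; by exists i; rewrite ui e eqxx.
have rho0 j : u (rho j) != 0 by case/andP: (rhoP j).
have hrho j : h (rho j) = enum_val (cast_ord (esym cP) j).
  by case/andP: (rhoP j) => _ /eqP.
exists rho; split=> // [j l /eqP|i ui].
  rewrite -hE// => /eqP; rewrite !hrho => /enum_val_inj/cast_ord_inj.
  exact: esym.
exists (cast_ord cP (enum_rank_in (inP i ui) (h i))); apply/eqP.
by rewrite -hE// hrho cast_ordK enum_rankK_in// inP.
Qed.

End NormalizedFrame.

Lemma labelled_partition_sum (T : finType) (m : nat) (A : 'I_m -> {set T})
    (V : nmodType) (F : T -> V) : labelled_partition A ->
  \sum_i F i = \sum_(j < m) \sum_(i in A j) F i.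
Proof.
move=> [disj cover]; rewrite -partition_disjoint_bigcup// cover.
by apply: eq_bigl => i; rewrite inE.
Qed.

(** * The bound for frames and the two directions of the equality case *)

Section Extremal.
Variables (R : realType) (k : scalar_kind) (n N : nat).
Hypothesis n_ge2 : (2 <= n)%N.
Local Notation K := (scalars R k).
Local Notation r := (real_rank R k).
Local Notation d := (max_equiangular k n).
Variables (u : 'I_N -> 'rV[K]_n) (t : 'I_N -> R).
Hypotheses (hu : tight_frame u 1) (t0 : forall i, 0 <= t i).
Hypothesis tt : \sum_i t i ^+ 2 = 1.
Let q : R := Num.sqrt (n%:R + r).
Let s i := euclidean_norm (u i).
Let S := \sum_i \sum_j t i * t j * modulus (inner (u i) (u j)).

Let n_gt0 : (0 < n)%N. Proof. exact: ltnW. Qed.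
Let q_gt1 : 1 < q. Proof. exact: inv_angle_gt1. Qed.
Let q_gt0 : 0 < q. Proof. exact: lt_trans q_gt1. Qed.
Let d_gt1 : 1 < d%:R :> R. Proof. exact: max_equiangular_gt1. Qed.
Let d_gt0 : (0 < d)%N. Proof. by rewrite -(ltr0n R) (lt_trans _ d_gt1). Qed.
Let s0 i : 0 <= s i. Proof. exact: euclidean_norm_ge0. Qed.
Let s_eq0 i : (s i == 0) = (u i == 0). Proof. exact: euclidean_norm_eq0. Qed.

Let ss : \sum_i s i ^+ 2 = n%:R.
Proof. by rewrite -(tight_frame_trace hu) mul1r. Qed.

Let SE : S = \sum_i \sum_j (t i * s i) * (t j * s j) * cosine u i j.
Proof.
apply: eq_bigr => i _; apply: eq_bigr => j _.
by rewrite modulus_inner_cosine -/(s i) -/(s j); ring.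
Qed.

Lemma frame_sum_le : S <= delta R k n.
Proof.
rewrite SE (deltaE R k n_ge2).
exact: (kernel_bound (natr_gt1 R n_ge2) (real_rank_le R k n_ge2) q_gt0
  (sqr_inv_angle R k n) s0 t0 tt ss (cosine_ge0 u) (cosine_le1 u) (cosineC u)
  (fun i => cosine_parseval i hu) (fun v => cosine_moment n_gt0 (v := v))).
Qed.

Section Structure.
Hypothesis extremal : S = delta R k n.

Let extremal' :
  \sum_i \sum_j (t i * s i) * (t j * s j) * cosine u i j = q - r / (q + 1).
Proof. by rewrite -SE extremal (deltaE R k n_ge2). Qed.

Lemma frame_extremal_norms i : s i = Num.sqrt n%:R * t i.
Proof.
exact: (extremal_norms (natr_gt1 R n_ge2) (real_rank_le R k n_ge2) q_gt0
  (sqr_inv_angle R k n) s0 t0 tt ss (cosine_ge0 u) (cosine_le1 u) (cosineC u)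
  (fun i => cosine_parseval i hu) (fun v => cosine_moment n_gt0 (v := v))
  extremal').
Qed.

Lemma frame_extremal_angles i j : u i != 0 -> u j != 0 ->
  cosine u i j = 1 \/ q * cosine u i j = 1.
Proof.
rewrite -!s_eq0.
exact: (extremal_angles (natr_gt1 R n_ge2) (real_rank_le R k n_ge2) q_gt0
  (sqr_inv_angle R k n) s0 t0 tt ss (cosine_ge0 u) (cosine_le1 u) (cosineC u)
  (fun i => cosine_parseval i hu) (fun v => cosine_moment n_gt0 (v := v))
  extremal').
Qed.

Lemma frame_extremal_weights i : u i != 0 ->
  \sum_(j | (u j != 0) && (cosine u i j == 1)) t j ^+ 2 = 1 / d%:R.
Proof.
rewrite -s_eq0 => si; rewrite max_equiangularE div1r invf_div.
rewrite -(extremal_weights (natr_gt1 R n_ge2) (real_rank_gt0 R k)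
  (real_rank_le R k n_ge2) q_gt0
  (sqr_inv_angle R k n) s0 t0 tt ss (cosine_ge0 u) (cosine_le1 u) (cosineC u)
  (fun i => cosine_parseval i hu) (fun v => cosine_moment n_gt0 (v := v))
  extremal' si).
by apply: eq_bigl => j; rewrite s_eq0.
Qed.

Let t_eq0 i : (t i == 0) = (u i == 0).
Proof.
rewrite -s_eq0 frame_extremal_norms mulf_eq0.
by rewrite (gt_eqF (_ : 0 < Num.sqrt n%:R)) ?sqrtr_gt0 ?ltr0n.
Qed.

(** The [w j] are normalised representatives of the collinearity classes, and the blocks are these
    classes. Equal class weights make the [w j] a tight frame. *)
Lemma extremal_structure :
  exists (w : 'I_d -> 'rV[K]_n) (A : 'I_d.+1 -> {set 'I_N}),
   maximal_ETF w /\ labelled_partition A /\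
   (A ord0 = [set i | u i == 0] /\ forall i : 'I_N, t i = 0 <-> i \in A ord0) /\
   (forall (j : 'I_d) (i : 'I_N), i \in A (lift ord0 j) ->
      exists a : K, modulus a = 1 /\ of_real k (s i)^-1 *: u i = a *: w j) /\
   (forall j : 'I_d, \sum_(i in A (lift ord0 j)) t i ^+ 2 = 1 / d%:R) /\
   (forall i : 'I_N, s i = Num.sqrt n%:R * t i).
Proof.
have t1 : \sum_(i | u i != 0) t i ^+ 2 = 1.
  rewrite -[RHS]tt [RHS](bigID (fun i => u i == 0)) /=.
  rewrite [X in X + _]big1 ?add0r// => i.
  by rewrite -t_eq0 => /eqP ->; rewrite expr0n.
have [rho [rho0 rho_inj rho_ex]] :=
  cosine_representatives d_gt0 t1 frame_extremal_weights.
pose w j := unit_vector u (rho j).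
(* Index 0 is reserved for the zero vectors, so class [j] sits at [lift ord0 j]. *)
pose A (j' : 'I_d.+1) := match unlift ord0 j' with
  | None => [set i | u i == 0]
  | Some j => [set i | (u i != 0) && (cosine u (rho j) i == 1)]
  end.
have A0 : A ord0 = [set i | u i == 0] by rewrite /A unlift_none.
have AS j : A (lift ord0 j) = [set i | (u i != 0) && (cosine u (rho j) i == 1)].
  by rewrite /A liftK.
have rho_uniq i j l : cosine u (rho j) i = 1 -> cosine u (rho l) i = 1 ->
    u i != 0 -> j = l.
  move=> ji li ui; apply: rho_inj.
  by rewrite (cosine1_trans (rho l) (rho0 j) ui ji) cosineC.
have Apart : labelled_partition A.
  split.
    move=> i j; case: (unliftP ord0 i) => [i'|] ->;
      case: (unliftP ord0 j) => [j'|] -> ij;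
      rewrite -setI_eq0; apply/eqP/setP => l; rewrite ?A0 ?AS !inE.
    - apply: contraNF ij => /andP[/andP[ul /eqP il] /andP[_ /eqP jl]].
      by rewrite (rho_uniq _ _ _ il jl ul).
    - by case: (u l == 0) => //; rewrite andbF.
    - by case: (u l == 0).
    - by rewrite eqxx in ij.
  apply/setP => i; rewrite inE; apply/bigcupP.
  have [ui|ui] := eqVneq (u i) 0; first by exists ord0; rewrite // A0 inE ui.
  have [j ij] := rho_ex i ui; exists (lift ord0 j) => //.
  by rewrite AS inE ui ij eqxx.
have A_col j i : i \in A (lift ord0 j) ->
    exists2 z : K, modulus z = 1 & unit_vector u i = z *: w j.
  rewrite AS inE => /andP[ui]; rewrite cosineC => /eqP ij.
  exact: cosine1_eq ui (rho0 j) ij.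
have A_weight j : \sum_(i in A (lift ord0 j)) t i ^+ 2 = 1 / d%:R.
  rewrite AS -(frame_extremal_weights (rho0 j)).
  by apply: eq_bigl => i; rewrite inE.
exists w, A; split; last split; last split; last split; last split => //.
- split; first split.
  + move=> j l jl; apply: rho_inj.
    by rewrite /cosine -/(w j) -/(w l) jl -/(cosine u (rho l) (rho l)) cosine_self.
  + by move=> j; exact: unit_vector_norm.
  + exists q^-1 => j l jl; have jl' : j != l by rewrite -(inj_eq val_inj) ltn_eqF.
    case: (frame_extremal_angles (rho0 j) (rho0 l)) => [/rho_inj e|e].
      by rewrite e eqxx in jl'.
    by rewrite -[LHS](mulKf (lt0r_neq0 q_gt0)) e mulr1.
  (* In block [j] the frame term of [u i] is [n t_i^2] times that of [w j], since the unimodular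
     factors cancel; the block weight [1/d] gives the constant [n/d]. *)
  + exists (n%:R / d%:R) => x; rewrite {1}(hu x) rmorph1 scale1r.
    rewrite (labelled_partition_sum _ Apart) big_ord_recl big1 => [|i]; last first.
      by rewrite A0 inE => /eqP ->; rewrite scaler0.
    rewrite add0r scaler_sumr; apply: eq_bigr => j _.
    transitivity (\sum_(i in A (lift ord0 j))
        of_real k (n%:R * t i ^+ 2) *: (inner x (w j) *: w j)).
      apply: eq_bigr => i /A_col[z z1 e].
      rewrite (scale_unit_vector u i) e innerZr innerZr !scalerA conj_of_real.
      congr (_ *: _); have := mul_conj_scalar z; rewrite z1 expr1n rmorph1 => zz.
      have -> : of_real k (n%:R * t i ^+ 2) = of_real k (s i) * of_real k (s i).
        rewrite -rmorphM frame_extremal_norms; congr of_real.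
        by rewrite mulrACA -expr2 sqr_sqrtr.
      rewrite -[RHS]mulr1 -zz; ring.
    by rewrite -scaler_suml -rmorph_sum -mulr_sumr A_weight div1r.
- exact: Apart.
- split=> // i; rewrite A0 inE -t_eq0; split=> [->|/eqP//].
  by rewrite eqxx.
- by move=> j i /A_col[z z1 e]; exists z.
- exact: frame_extremal_norms.
Qed.

End Structure.

(** Grouping by blocks replaces the frame by the ETF with uniform weights, so that the sum becomes
    [n / d * (1 + (d - 1) / q)]. *)
Lemma extremal_of_structure (w : 'I_d -> 'rV[K]_n) (A : 'I_d.+1 -> {set 'I_N}) :
   maximal_ETF w -> labelled_partition A ->
   A ord0 = [set i | u i == 0] -> 
   (forall (j : 'I_d) (i : 'I_N), i \in A (lift ord0 j) ->
      exists a : K, modulus a = 1 /\ of_real k (s i)^-1 *: u i = a *: w j) ->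
   (forall j : 'I_d, \sum_(i in A (lift ord0 j)) t i ^+ 2 = 1 / d%:R) ->
   (forall i : 'I_N, s i = Num.sqrt n%:R * t i) ->
   S = delta R k n.
Proof.
move=> etf Apart A0 col wt nrm.
have angle := maximal_ETF_angle n_ge2 etf.
have [[_ w1 _] _] := etf.
have cosE i i' j l : i \in A (lift ord0 j) -> i' \in A (lift ord0 l) ->
    cosine u i i' = modulus (inner (w j) (w l)).
  move=> /col[a [a1 ea]] /col[b [b1 eb]].
  rewrite /cosine /unit_vector ea eb innerZl innerZr !modulusM.
  by rewrite modulus_conj a1 b1 !mul1r.
(* Block 0 holds only zero vectors, so it drops out of every sum supported on [s i != 0]. *)
have split_sum (F : 'I_N -> R) : (forall i, s i = 0 -> F i = 0) ->
    \sum_i F i = \sum_(j < d) \sum_(i in A (lift ord0 j)) F i.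
  move=> F0; rewrite (labelled_partition_sum _ Apart) big_ord_recl.
  rewrite big1 ?add0r// => i; rewrite A0 inE -s_eq0 => /eqP; exact: F0.
have sqrtn : Num.sqrt n%:R ^+ 2 = n%:R :> R by rewrite sqr_sqrtr.
have -> : S = \sum_(j < d) \sum_(l < d)
    n%:R / d%:R ^+ 2 * modulus (inner (w j) (w l)).
  rewrite SE split_sum => [|i si]; last first.
    by rewrite big1// => j _; rewrite si mulr0 !mul0r.
  apply: eq_bigr => j _.
  transitivity (\sum_(i in A (lift ord0 j)) t i ^+ 2 *
     \sum_(l < d) n%:R / d%:R * modulus (inner (w j) (w l))).
    apply: eq_bigr => i ij; rewrite split_sum => [|i' si]; last first.
      by rewrite si !mulr0 mul0r.
    rewrite mulr_sumr; apply: eq_bigr => l _.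
    transitivity (\sum_(i' in A (lift ord0 l))
        t i ^+ 2 * n%:R * modulus (inner (w j) (w l)) * t i' ^+ 2).
      by apply: eq_bigr => i' il; rewrite (cosE _ _ _ _ ij il) !nrm; ring: sqrtn.
    by rewrite -mulr_sumr wt div1r; ring.
  rewrite -mulr_suml wt mulr_sumr; apply: eq_bigr => l _.
  by rewrite div1r expr2 invfM; ring.
have d_neq0 : d%:R != 0 :> R by rewrite pnatr_eq0 -lt0n.
have n_neq0 : n%:R != 0 :> R by rewrite pnatr_eq0 -lt0n.
(* Each row of the ETF Gram matrix has one modulus 1 and [d - 1] moduli [1/q]. *)
rewrite (eq_bigr (fun=> n%:R / d%:R ^+ 2 * (1 + (d%:R - 1) / q))) => [|j _].
  rewrite sumr_const card_ord -[LHS]mulr_natr (deltaE R k n_ge2) -/q.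
  have q1 := q_gt1; have qq : q ^+ 2 = n%:R + r := sqr_inv_angle R k n.
  have -> : n%:R / d%:R ^+ 2 * (1 + (d%:R - 1) / q) * d%:R =
      n%:R / d%:R * (1 + (d%:R - 1) / q).
    by field; rewrite d_neq0 lt0r_neq0.
  have r_neq0 := lt0r_neq0 (real_rank_gt0 R k).
  have nE : n%:R = q ^+ 2 - r by rewrite qq addrK.
  rewrite max_equiangularE; rewrite nE in n_neq0 *; field.
  rewrite r_neq0 n_neq0 lt0r_neq0 ?addr_gt0//= lt0r_neq0//= subrK andbT.
  by rewrite gt_eqF//; nra.
rewrite -mulr_sumr; congr (_ * _); rewrite (bigD1 j)//=.
rewrite inner_self w1 expr1n modulus_of_real normr1; congr (_ + _).
rewrite (eq_bigr (fun=> q^-1)) => [|l lj]; last by rewrite angle// eq_sym.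
by rewrite sumr_const cardC1 card_ord -[LHS]mulr_natl -subn1 natrB.
Qed.

End Extremal.

Theorem theorem1p1 (R : realType) (k : scalar_kind) (n N : nat)
    (hn : (2 <= n)%N) (hN : (n <= N)%N)
    (u : 'I_N -> 'rV[scalars R k]_n) (hu : tight_frame u 1)
    (t : 'rV[R]_N) (ht0 : forall i, 0 <= t 0 i)
    (ht1 : @euclidean_norm R RealScalars N t = 1) :
  let d := max_equiangular k n in
  let S := \sum_(i < N) \sum_(j < N) t 0 i * t 0 j * modulus (inner (u i) (u j)) in
  S <= delta R k n /\
  (S = delta R k n <->
   exists (w : 'I_d -> 'rV[scalars R k]_n) (A : 'I_d.+1 -> {set 'I_N}),
     maximal_ETF w /\ labelled_partition A /\
     (A ord0 = [set i | u i == 0] /\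
      forall i : 'I_N, t 0 i = 0 <-> i \in A ord0) /\
     (forall (j : 'I_d) (i : 'I_N), i \in A (lift ord0 j) ->
        exists a : scalars R k,
          modulus a = 1 /\
          of_real k (euclidean_norm (u i))^-1 *: u i = a *: w j) /\
     (forall j : 'I_d, \sum_(i in A (lift ord0 j)) t 0 i ^+ 2 = 1 / d%:R) /\
     (forall i : 'I_N, euclidean_norm (u i) = Num.sqrt n%:R * t 0 i)).
Proof.
have tt : \sum_i t 0 i ^+ 2 = 1.
  have := @sqr_euclidean_norm R RealScalars N t.
  rewrite ht1 expr1n => ->; apply: eq_bigr => i _ /=.
  by rewrite real_normK ?num_real.
split; first exact: frame_sum_le.
split=> [/extremal_structure|[w [A [etf [part [[A0 _] [col [wt nrm]]]]]]]].
  exact.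
exact: extremal_of_structure etf part A0 col wt nrm.
Qed.
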